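(* Let $g\in\mathcal{A}$ be eventually injective and let $f\in\mathcal{A}\setminus\mathcal{S}$. The set of functions $$\operatorname{Exp}^*\{\mathfrak{m}_g^i f: i\ge 0\}$$ is algebraically independent over the kernel of any infinite subset of $\Delta_f$, and hence over $\mathcal{S}$. In addition, if $g$ is nowhere vanishing, then the same holds with $i$ ranging through the integers, i.e. for $\operatorname{Exp}^*\{\mathfrak{m}_g^i f: i\in\mathbb{Z}\}$.
   Context: $\mathbb{N}=\{1,2,3,\dots\}$. An arithmetic function is a function $f:\mathbb{N}\to\mathbb{C}$. $\mathcal{A}$ is the commutative $\mathbb{C}$-algebra (an integral domain) of arithmetic functions under pointwise addition and convolution $(f*g)(n)=\sum_{d\mid n}f(d)g(n/d)$; $\alpha\in\mathbb{C}$ is identified with the function $1\mapsto\alpha$, $n\mapsto 0$ for $n>1$. Algebraic independence refers to this ring; all products and powers of arithmetic functions are convolutions unless stated otherwise. $g$ is eventually injective if there is $n_0$ such that $g$ is injective on $\{n\in\mathbb{N}:n\ge n_0\}$. $\mathfrak{m}_g:\mathcal{A}\to\mathcal{A}$ is pointwise multiplication by $g$: $(\mathfrak{m}_gf)(n)=g(n)f(n)$; $\mathfrak{m}_g^i$ is its $i$-th iterate, $\mathfrak{m}_g^0=\mathrm{id}$, and if $g$ is nowhere vanishing negative iterates are those of the inverse map. $\operatorname{supp} f=\{n:f(n)\ne0\}$; for $A\subseteq\mathbb{N}$, $[A]$ is the set of primes dividing some member of $A$. $\mathcal{S}$ is the subalgebra of all $f\in\mathcal{A}$ with $[\operatorname{supp}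 f]$ finite. For a prime $p$, $\partial_p$ is the derivation of $\mathcal{A}$ given by $(\partial_pf)(n)=v_p(np)f(np)$, where $v_p(m)$ is the exponent of $p$ in $m$. $\Delta_f=\{\partial_p:p\in[\operatorname{supp} f]\}$. The kernel of a set $\Delta$ of derivations is $\{x\in\mathcal{A}:Dx=0\ \forall D\in\Delta\}$. For $f\ne 0$ let $v(f)$ be the least element of $\operatorname{supp} f$, and $v(0)=\infty$; $\|f\|=1/v(f)$ is a non-archimedean norm giving a topology on $\mathcal{A}$. If $f(1)=0$, $\operatorname{Exp}(f)=\sum_{k\ge0}f^k/k!$ (convergent in this topology); in general $\operatorname{Exp}(f)=\exp(f(1))*\operatorname{Exp}(f-f(1))$. Let $\mathcal{A}_{\mathbb{R}}=\{f:f(1)\in\mathbb{R}\}$ and $\mathcal{A}_+=\{f:f(1)\in\mathbb{R},\,f(1)>0\}$. $\operatorname{Exp}$ restricts to a group isomorphism $(\mathcal{A}_{\mathbb{R}},+)\to(\mathcal{A}_+,* )$ with inverse $\operatorname{Log}$. $\operatorname{Exp}^m$ denotes $m$-fold composition for $m\ge 0$, and $\operatorname{Exp}^{-k}=\operatorname{Log}^k$ (where defined) for $k\ge1$. For each $f\in\mathcal{A}$ there is a largest $k\ge0$ such that $\operatorname{Log}^kf$ is defined. For nonempty $W\subseteq\mathcal{A}$, $k_W$ is the largest $k\ge0$ such that $\operatorname{Log}^{k}f$ is defined for every $f\in W$, and $\operatorname{Exp}^*W=\{\operatorname{Exp}^mf: f\in W,\ m\in\mathbb{Z},\ m\ge -k_W\}$.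 *)

(* Defs.v *)
From HB Require Import structures.
From mathcomp Require Import all_boot all_order all_algebra.
From mathcomp Require Import complex.
From mathcomp.multinomials Require mpoly.
From mathcomp Require Import boolp classical_sets functions cardinality reals.
From mathcomp Require Import topology sequences exp trigo.
(* The notations of mpoly clash with those of MathComp-Analysis. *)
Import -(notations) mpoly.

Set Implicit Arguments.
Unset Strict Implicit.
Unset Printing Implicit Defensive.

Import Order.TTheory GRing.Theory Num.Theory.
Local Open Scope classical_set_scope.
Local Open Scope ring_scope.

(* An arithmetic function N = {1, 2, 3, ...} -> C is represented by its
   extension by 0 to [nat]; the value at the junk argument 0 is thus fixed, so
   that equality in [arith R] is equality of functions on {1, 2, 3, ...}. *)
Record arith (R : realType) := Arith {
  arith_fun :> nat -> R[i];
  arith_fun0 : arith_fun 0%N = 0 }.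

Section Algebra.
Variable R : realType.
Local Notation A := (arith R).
Implicit Types f g h : A.

Lemma arithP f g : (forall n, (0 < n)%N -> f n = g n) -> f = g.
Proof.
case: f g => [f f0] [g g0] /= fg.
have e : f = g by apply/funext => -[|n]; rewrite ?f0 ?g0 ?fg.
by case: _ / e g0 {fg} => g0; congr Arith; exact: Prop_irrelevance.
Qed.

HB.instance Definition _ := gen_eqMixin A.
HB.instance Definition _ := gen_choiceMixin A.

Definition arith_zero : A := @Arith R (fun=> 0) erefl.

Fact arith_opp_subproof f : - f 0%N = 0.
Proof. by rewrite arith_fun0 oppr0. Qed.
Definition arith_opp f : A := @Arith R (fun n => - f n) (arith_opp_subproof f).

Fact arith_add_subproof f g : f 0%N + g 0%N = 0.
Proof. by rewrite !arith_fun0 addr0. Qed.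
Definition arith_add f g : A :=
  @Arith R (fun n => f n + g n) (arith_add_subproof f g).

Fact arith_addA : associative arith_add.
Proof. by move=> f g h; apply: arithP => n _ /=; rewrite addrA. Qed.
Fact arith_addC : commutative arith_add.
Proof. by move=> f g; apply: arithP => n _ /=; rewrite addrC. Qed.
Fact arith_add0 : left_id arith_zero arith_add.
Proof. by move=> f; apply: arithP => n _ /=; rewrite add0r. Qed.
Fact arith_addN : left_inverse arith_zero arith_opp arith_add.
Proof. by move=> f; apply: arithP => n _ /=; rewrite addNr. Qed.

HB.instance Definition _ := GRing.isZmodule.Build A
  arith_addA arith_addC arith_add0 arith_addN.

Definition arith_one : A := @Arith R (fun n => (n == 1%N)%:R) erefl.

Fact arith_conv_subproof f g :
  \sum_(d <- divisors 0) f d * g (0 %/ d)%N = 0.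
Proof. by rewrite big1 // => d _; rewrite div0n arith_fun0 mulr0. Qed.
Definition arith_conv f g : A :=
  @Arith R (fun n => \sum_(d <- divisors n) f d * g (n %/ d)%N)
    (arith_conv_subproof f g).

Lemma arith_convE f g n N : (0 < n)%N -> (n < N)%N ->
  arith_conv f g n = \sum_(a < N) \sum_(b < N | (a * b == n)%N) f a * g b.
Proof.
move=> n0 nN /=.
transitivity (\sum_(a < N | (a %| n)%N) f a * g (n %/ a)%N).
  rewrite -(big_mkord (fun a => (a %| n)%N) (fun a => f a * g (n %/ a)%N)).
  rewrite -[RHS]big_filter; apply: perm_big; apply: uniq_perm.
  - exact: divisors_uniq.
  - by rewrite filter_uniq // iota_uniq.
  move=> d; rewrite mem_filter mem_index_iota -dvdn_divisors //=.
  case: (boolP (d %| n)%N) => //= dn.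
  by rewrite (leq_ltn_trans (dvdn_leq n0 dn) nN).
rewrite big_mkcond; apply: eq_bigr => a _.
case: ifPn => an; last first.
  rewrite big1 // => b /eqP e; case/negP: an; rewrite -e; exact: dvdn_mulr.
have bN : (n %/ a < N)%N by rewrite (leq_ltn_trans (leq_div _ _)).
rewrite (big_pred1 (Ordinal bN)) // => b /=.
have a0 : (0 < a)%N by case: (a : nat) an n0 => // /eqP; rewrite modn0 => ->.
by rewrite -val_eqE /= eqn_div // mulnC.
Qed.


Fact arith_convC : commutative arith_conv.
Proof.
move=> f g; apply: arithP => n n0; rewrite !(arith_convE _ _ n0 (ltnSn n)).
under eq_bigr do rewrite big_mkcond.
rewrite exchange_big /=; apply: eq_bigr => a _.
rewrite [RHS]big_mkcond; apply: eq_bigr => b _.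
by rewrite mulnC mulrC.
Qed.

Fact arith_convA : associative arith_conv.
Proof.
suff convE3 f g h n : (0 < n)%N ->
    arith_conv f (arith_conv g h) n =
    \sum_(a < n.+1) \sum_(b < n.+1) \sum_(c < n.+1)
      if (a * (b * c) == n)%N then f a * (g b * h c) else 0.
  move=> f g h; apply: arithP => n n0; rewrite [arith_conv (arith_conv f g) h]arith_convC !convE3 //.
  rewrite [RHS]exchange_big /=; apply: eq_bigr => a _.
  rewrite [RHS]exchange_big /=; apply: eq_bigr => b _.
  apply: eq_bigr => c _; rewrite [(c * _)%N]mulnC mulnA.
  by rewrite [h c * _]mulrC mulrA.
move=> n0; rewrite (arith_convE _ _ n0 (ltnSn n)); apply: eq_bigr => a _.
transitivity (\sum_(m < n.+1 | (a * m == n)%N) \sum_(b < n.+1)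
    \sum_(c < n.+1) if (b * c == m)%N then f a * (g b * h c) else 0).
  apply: eq_bigr => m /eqP am.
  have m0 : (0 < m)%N by case: (m : nat) am n0 => // <-; rewrite muln0.
  rewrite (arith_convE _ _ m0 (ltn_ord m)) mulr_sumr; apply: eq_bigr => b _.
  by rewrite mulr_sumr -big_mkcond.
rewrite exchange_big /=; apply: eq_bigr => b _.
rewrite exchange_big /=; apply: eq_bigr => c _.
case: ifPn => [/eqP abc|abc]; last first.
  rewrite big1 // => m /eqP am; case: ifP => // /eqP bc.
  by case/eqP: abc; rewrite bc.
have bcn : (b * c < n.+1)%N.
  have a0 : (0 < a)%N by case: (a : nat) abc n0 => // <-; rewrite mul0n.
  by have := leq_pmull (b * c) a0; rewrite abc ltnS.
rewrite (bigD1 (Ordinal bcn)) /= ?abc // eqxx big1 ?addr0 // => m.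
by rewrite -val_eqE /= => /andP[_ /negPf mbc]; rewrite eq_sym mbc.
Qed.

Fact arith_conv1 : left_id arith_one arith_conv.
Proof.
move=> f; apply: arithP => n n0; rewrite (arith_convE _ _ n0 (ltnSn n)).
have n1 : (1 < n.+1)%N by [].
rewrite (bigD1 (Ordinal n1)) //= [X in _ + X]big1 ?addr0; last first.
  move=> a; rewrite -val_eqE /= => /negPf a1.
  by rewrite big1 // => b _; rewrite a1 mul0r.
by rewrite (big_pred1 ord_max) => [|b]; rewrite ?mul1r // mul1n.
Qed.

Fact arith_convDl : left_distributive arith_conv arith_add.
Proof.
move=> f g h; apply: arithP => n _ /=.
by rewrite -big_split; apply: eq_bigr => d _; rewrite mulrDl.
Qed.

Fact arith_one_neq0 : arith_one != 0.
Proof.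
apply/eqP => /(congr1 (fun f : A => f 1%N)) /eqP.
by rewrite /= oner_eq0.
Qed.

HB.instance Definition _ := GRing.Zmodule_isComNzRing.Build A
  arith_convA arith_convC arith_conv1 arith_convDl arith_one_neq0.

Fact arith_scale_subproof (a : R[i]) f : a * f 0%N = 0.
Proof. by rewrite arith_fun0 mulr0. Qed.
Definition arith_scale (a : R[i]) f : A :=
  @Arith R (fun n => a * f n) (arith_scale_subproof a f).

Fact arith_scaleA a b f :
  arith_scale a (arith_scale b f) = arith_scale (a * b) f.
Proof. by apply: arithP => n _ /=; rewrite mulrA. Qed.
Fact arith_scale1 : left_id 1 arith_scale.
Proof. by move=> f; apply: arithP => n _ /=; rewrite mul1r. Qed.
Fact arith_scaleDr : right_distributive arith_scale +%R.
Proof. by move=> a f g; apply: arithP => n _ /=; rewrite mulrDr. Qed.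
Fact arith_scaleDl f : {morph arith_scale^~ f : a b / a + b}.
Proof. by move=> a b; apply: arithP => n _ /=; rewrite mulrDl. Qed.

HB.instance Definition _ := GRing.Zmodule_isLmodule.Build R[i] A
  arith_scaleA arith_scale1 arith_scaleDr arith_scaleDl.

Fact arith_scaleAl (a : R[i]) f g : a *: (f * g) = a *: f * g.
Proof.
apply: arithP => n _ /=; rewrite mulr_sumr.
by apply: eq_bigr => d _; rewrite mulrA.
Qed.

HB.instance Definition _ := GRing.Lmodule_isLalgebra.Build R[i] A arith_scaleAl.
HB.instance Definition _ := GRing.Lalgebra_isComAlgebra.Build R[i] A.

End Algebra.

Section Norm.
Variable R : realType.
Local Notation A := (arith R).
Implicit Types f g h : A.

Definition asupp f : set nat := [set n | f n != 0].

(* 1 / v(f), where v(f) is the least element of the support, and v(0) = oo. *)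
Definition anorm f : R :=
  if pselect (exists n, f n != 0) is left f_neq0
  then (ex_minn f_neq0)%:R^-1 else 0.

Variant anorm_spec f : R -> Prop :=
  | AnormZero of f = 0 : anorm_spec f 0
  | AnormVal n of (0 < n)%N & f n != 0 & (forall m, f m != 0 -> (n <= m)%N) :
      anorm_spec f n%:R^-1.

Lemma anormP f : anorm_spec f (anorm f).
Proof.
rewrite /anorm; case: pselect => [fn0|f0].
  case: ex_minnP => n fn nmin; apply: AnormVal => //.
  by case: n fn {nmin} => //; rewrite arith_fun0 eqxx.
apply: AnormZero; apply: arithP => n _; apply/eqP; rewrite -[_ == _]negbK.
by apply/negP => fn; apply: f0; exists n.
Qed.

Lemma anorm_ge f n : f n != 0 -> n%:R^-1 <= anorm f.
Proof.
case: anormP => [->|v v0 _ vmin fn]; first by rewrite eqxx.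
by rewrite lef_pV2 ?ler_nat ?vmin // posrE ltr0n // (leq_trans v0) ?vmin.
Qed.

Lemma anorm_ge0 f : 0 <= anorm f.
Proof. by case: anormP => // n _ _ _; rewrite invr_ge0. Qed.

Lemma anorm0 : anorm 0 = 0.
Proof. by case: anormP => // n _ /=; rewrite eqxx. Qed.

Lemma anorm_eq0 f : anorm f = 0 -> f = 0.
Proof. by case: anormP => // n n0 _ _ /eqP; rewrite invr_eq0 pnatr_eq0 gtn_eqF. Qed.

Lemma anormN f : anorm (- f) = anorm f.
Proof.
suff le_anormN h : anorm (- h) <= anorm h.
  by apply: le_anti; rewrite le_anormN -{1}[f]opprK le_anormN.
case: (anormP (- h)) => [_|n _ hn _]; first exact: anorm_ge0.
by rewrite anorm_ge // -oppr_eq0.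
Qed.

Lemma anormD f g : anorm (f + g) <= Num.max (anorm f) (anorm g).
Proof.
case: (anormP (f + g)) => [_|n _ fgn _]; first by rewrite le_max anorm_ge0.
rewrite le_max; case: (eqVneq (f n) 0) => [f0|/anorm_ge -> //].
by rewrite (@anorm_ge g n) ?orbT //; move: fgn; rewrite /= f0 add0r.
Qed.

Definition amdist f g : R := anorm (f - g).

Fact amdistxx f : amdist f f = 0.
Proof. by rewrite /amdist subrr anorm0. Qed.
Fact amdist_eq0 f g : amdist f g = 0 -> f = g.
Proof. by move=> /anorm_eq0/eqP; rewrite subr_eq0 => /eqP. Qed.
Fact amdist_sym f g : amdist f g = amdist g f.
Proof. by rewrite /amdist -opprB anormN. Qed.
Fact amdist_triangle g f h : amdist f h <= amdist f g + amdist g h.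
Proof.
rewrite /amdist -(subrKA g); apply: (le_trans (anormD _ _)).
by rewrite ge_max lerDl lerDr !anorm_ge0.
Qed.

HB.instance Definition _ := isPointed.Build A 0.
HB.instance Definition _ :=
  isMetric.Build R A amdistxx amdist_eq0 amdist_sym amdist_triangle.

End Norm.

Section Exponential.
Variable R : realType.
Local Notation A := (arith R).
Implicit Types (f g h : A) (W : set A).

Definition cexp (z : R[i]) : R[i] :=
  let: (a +i* b)%C := z in ((expR a * cos b) +i* (expR a * sin b))%C.

Definition Exp0 f : A := limn (series (fun k => (k`!%:R : R[i])^-1 *: f ^+ k)).

Lemma arith_expr_small f k n : f 1%N = 0 -> (n <= k)%N -> (f ^+ k) n = 0.
Proof.
move=> f1; elim: k n => [|k IH] n.
  by rewrite leqn0 => /eqP ->; rewrite arith_fun0.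
move=> nk; rewrite exprS /=.
case: (posnP n) => [->|n0]; first by rewrite arith_conv_subproof.
rewrite big_seq big1 // => d; rewrite -dvdn_divisors // => dn.
case: d dn => [|[|d]] dn; rewrite ?f1 ?mul0r ?arith_fun0 ?mul0r //.
rewrite IH ?mulr0 // -ltnS; apply: leq_trans nk; exact: ltn_Pdiv.
Qed.

Lemma arith_sumE (I : Type) (r : seq I) (P : pred I) (F : I -> A) n :
  (\sum_(i <- r | P i) F i) n = \sum_(i <- r | P i) F i n.
Proof. by elim/big_rec2: _ => // i x y _ <-. Qed.

Fact Exp0_sum_subproof f : \sum_(k < 0) (k`!%:R : R[i])^-1 * (f ^+ k) 0%N = 0.
Proof. by rewrite big_ord0. Qed.

Definition Exp0_sum f : A :=
  @Arith R (fun n => \sum_(k < n) (k`!%:R : R[i])^-1 * (f ^+ k) n)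
    (Exp0_sum_subproof f).

(* Hence [limn] in [Exp0 f] is not a junk value when f(1) = 0. *)
Lemma Exp0_cvg f : f 1%N = 0 ->
  (series (fun k => (k`!%:R : R[i])^-1 *: f ^+ k) : nat -> A) @ \oo
    --> Exp0_sum f.
Proof.
move=> f1; apply/cvg_ballP => e e0.
exists (Num.trunc e^-1).+1 => //= k /= ek.
rewrite ballEmdist /= /mdist /= /amdist.
case: anormP => // n n0 h _.
have kn : (k < n)%N.
  rewrite ltnNge; apply/negP => nk; case/eqP: h.
  rewrite /series /= arith_sumE /=; apply/eqP; rewrite subr_eq0; apply/eqP.
  rewrite big_mkord.
  rewrite (big_ord_widen k (fun i => (i`!%:R : R[i])^-1 * (f ^+ i) n) nk).
  rewrite big_mkcond; apply: eq_bigr => i _.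
  by case: ltnP => // ni; rewrite arith_expr_small ?mulr0.
rewrite invf_plt ?posrE ?ltr0n //.
apply: (lt_trans (truncnS_gt _)); rewrite ltr_nat.
exact: leq_ltn_trans ek kn.
Qed.

Lemma Exp0E f : f 1%N = 0 -> Exp0 f = Exp0_sum f.
Proof. by move=> f1; apply: cvg_lim; [exact: metric_hausdorff | exact: Exp0_cvg]. Qed.

Definition Exp f : A := (cexp (f 1%N))%:A * Exp0 (f - (f 1%N)%:A).

(* In the order of [R[i]], [0 < z] says that z is real and positive. *)
Definition areal : set A := [set f | f 1%N \is Num.real].
Definition apos : set A := [set f | 0 < f 1%N].

(* The inverse of [Exp : areal -> apos]; a junk value outside of [apos]. *)
Definition Log : A -> A := pinv areal Exp.

Fixpoint Log_defined (k : nat) f : Prop :=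
  if k is k'.+1 then apos f /\ Log_defined k' (Log f) else True.

Definition Log_defined_on W (k : nat) := forall f, W f -> Log_defined k f.

(* k_W, the largest k such that Log^k is defined on W. *)
Definition Log_depth W : nat :=
  xget 0%N [set k | Log_defined_on W k /\
                    forall j, Log_defined_on W j -> (j <= k)%N].

(* F^m for m : int, where Finv is the inverse of F. *)
Definition ziter (T : Type) (F Finv : T -> T) (m : int) : T -> T :=
  match m with Posz k => iter k F | Negz k => iter k.+1 Finv end.

Definition ExpStar W : set A :=
  [set ziter Exp Log m f | f in W & m in [set m : int | - (Log_depth W)%:Z <= m]].

End Exponential.

Section Operators.
Variable R : realType.
Local Notation A := (arith R).
Implicit Types (f g : A).

Definition eventually_injective g :=
  exists n0, set_inj [set n | (0 < n)%N /\ (n0 <= n)%N] g.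

Definition nowhere_vanishing g := forall n, (0 < n)%N -> g n != 0.

Fact ptmul_subproof g f : g 0%N * f 0%N = 0.
Proof. by rewrite !arith_fun0 mul0r. Qed.
Definition ptmul g f : A :=
  @Arith R (fun n => g n * f n) (ptmul_subproof g f).

(* m_g^i, for a nowhere vanishing g when i < 0. *)
Definition ptmulz g (i : int) : A -> A :=
  ziter (ptmul g) (pinv setT (ptmul g)) i.

Definition primes_of (X : set nat) : set nat :=
  [set p | prime p /\ exists2 n, X n & (p %| n)%N].

Definition Sfin : set A := [set f | finite_set (primes_of (asupp f))].

Fact pderiv_subproof p f : (logn p (0 * p))%:R * f (0 * p)%N = 0.
Proof. by rewrite mul0n logn0 mul0r. Qed.
Definition pderiv p f : A :=
  @Arith R (fun n => (logn p (n * p))%:R * f (n * p)%N) (pderiv_subproof p f).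

Definition Delta f : set (A -> A) := [set pderiv p | p in primes_of (asupp f)].

Definition dkernel (D : set (A -> A)) : set A :=
  [set x | forall d, D d -> d x = 0].

(* No nonzero polynomial with coefficients in K vanishes at distinct elements
   of X. *)
Definition alg_indep (K X : set A) : Prop :=
  forall (n : nat) (x : 'I_n -> A), injective x -> (forall i, X (x i)) ->
  forall P : mpoly n A, (forall m, K (mcoeff m P)) -> meval x P = 0 -> P = 0.

End Operators.

Arguments Sfin {R} _.

(* Main.v *)
From HB Require Import structures.
Require Import Defs.
From mathcomp Require Import all_boot all_order all_algebra perm.
From mathcomp Require Import complex.
From mathcomp Require Import boolp classical_sets functions cardinality reals.
From mathcomp Require Import exp trigo.
From mathcomp Require Import ring zify.
From mathcomp.multinomials Require mpoly.
Import -(notations) mpoly.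

Set Implicit Arguments.
Unset Strict Implicit.
Unset Printing Implicit Defensive.

Import Order.TTheory GRing.Theory Num.Theory.
Local Open Scope classical_set_scope.
Local Open Scope ring_scope.

(** Write W for the orbit of f under multiplication by g, k for the Log-depth
of W, and y_a = Log^k (m_g^a f).  Since Exp undoes Log, every element of
Exp^* W has the form Exp^m y_a with m >= 0, and a polynomial relation involves
only finitely many of the towers y_a, Exp y_a, Exp^2 y_a, ...  One may assume
0 <= a < r: for integer exponents, replace f by its product with a negative
power of g, which has the same support.

Jacobian.  For each p in an infinite set of primes of [supp f], let N_p be the
least multiple of p in supp f.  The function d_p (m_g^a f) vanishes below
N_p / p, where its value is g(N_p)^a times a nonzero number independent of a.
Convolution multiplies leading terms, so the determinant of the
d_(p_j) (m_g^a f) has, up to a nonzero factor, a Vandermonde determinant in the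
g(N_(p_j)) as its value at the product of the N_(p_j) / p_j.  Infinitely many
values N_p occur, hence eventual injectivity of g allows the g(N_(p_j)) to be
distinct, and the Jacobian is nonzero ([orbit_jacobian_neq0]).  As
D (Exp h) = Exp h * D h, passing from m_g^a f to y_a only rescales its columns
([log_orbit_jacobian_neq0]).

Separation.  Combining the d_(p_j) with the rows of the adjugate matrix gives
derivations D_a of the ring of arithmetic functions with D_a y_b = 0 for
b <> a and D_a y_a = d, the Jacobian determinant.  Then D_a kills every tower
but the a-th, and also every coefficient killed by the d_(p_j).

One tower.  It remains to see that a single tower t_0 = y, t_(m+1) = Exp t_m is
algebraically free over the kernel of a derivation D with D t_0 = d <> 0
([transcendental_tower]).  Let L be generated by this kernel and the t_j with
j < m.  If t_(m+1) were algebraic over L[t_m], take a relation of least degree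
n, with leading coefficient q and constant coefficient p.  Differentiating it
and eliminating the leading term gives q D p - p D q = n p q D t_m.  This is
impossible, because p and q are polynomials in t_m over L and the right-hand
side has larger degree in t_m than the left-hand side, up to the factor d on
both sides.

Finally, the elements of Exp^* W that occur in a polynomial relation are
adjoined in the order of their height m in the towers: each is transcendental
over a ring that contains its predecessors and the coefficients.  For the
coefficients in S, a relation involves finitely many of them, hence finitely
many primes; the remaining primes of [supp f] kill them all. *)

(** * Transcendence along a derivation *)

Section Transcendence.
Variable B : idomainType.
Implicit Types (L : subringClosed B) (a b p q : {poly B}) (d s t w : B).

Definition derivation (D : B -> B) :=
  {morph D : x y / x + y} /\ (forall x y, D (x * y) = D x * y + x * D y).

Definition transcendental (L : {pred B}) s :=
  forall p, p \is a polyOver L -> p.[s] = 0 -> p = 0.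

Definition adjoin (L : {pred B}) s : {pred B} :=
  fun x => `[< exists2 p, p \is a polyOver L & x = p.[s] >].

Lemma adjoinP L s x :
  reflect (exists2 p, p \is a polyOver L & x = p.[s]) (x \in adjoin L s).
Proof. exact: asboolP. Qed.

Fact adjoin_subring_closed L s : subring_closed (adjoin L s).
Proof.
split; first by apply/adjoinP; exists 1; rewrite ?rpred1 ?hornerC.
  move=> _ _ /adjoinP[p pL ->] /adjoinP[q qL ->].
  by apply/adjoinP; exists (p - q); rewrite ?rpredB // hornerD hornerN.
move=> _ _ /adjoinP[p pL ->] /adjoinP[q qL ->].
by apply/adjoinP; exists (p * q); rewrite ?rpredM // hornerM.
Qed.

HB.instance Definition _ L s :=
  GRing.isSubringClosed.Build B (adjoin L s) (adjoin_subring_closed L s).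

Lemma mem_adjoin_base L s x : x \in L -> x \in adjoin L s.
Proof. by move=> xL; apply/adjoinP; exists x%:P; rewrite ?polyOverC ?hornerC. Qed.

Lemma mem_adjoin_gen L s : s \in adjoin L s.
Proof. by apply/adjoinP; exists 'X; rewrite ?polyOverX ?hornerX. Qed.

Lemma deriv_sum p : p^`() = \sum_(i < size p) (p`_i *+ i) *: 'X^(i.-1).
Proof.
rewrite -[in LHS](coefK p) poly_def linear_sum; apply: eq_bigr => i _.
by rewrite linearZ /= derivXn -scalerMnr scalerMnl.
Qed.

Section Derivation.
Variable D : B -> B.
Hypothesis D_der : derivation D.

Let DD : {morph D : x y / x + y}. Proof. by case: D_der. Qed.
Let DM x y : D (x * y) = D x * y + x * D y. Proof. by case: D_der. Qed.

Lemma derivation0 : D 0 = 0.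
Proof. by apply: (addIr (D 0)); rewrite -DD !add0r. Qed.

Lemma derivation1 : D 1 = 0.
Proof. by apply: (addIr (D 1)); have := DM 1 1; rewrite !(mulr1, mul1r) add0r. Qed.

Lemma derivationN x : D (- x) = - D x.
Proof. by apply: (addIr (D x)); rewrite -DD !addNr derivation0. Qed.

Lemma derivationB x y : D (x - y) = D x - D y.
Proof. by rewrite DD derivationN. Qed.

Lemma derivation_sum I (r : seq I) (P : pred I) (F : I -> B) :
  D (\sum_(i <- r | P i) F i) = \sum_(i <- r | P i) D (F i).
Proof. exact: (big_morph D DD derivation0). Qed.

Lemma derivationX x n : D (x ^+ n) = (x ^+ n.-1 * D x) *+ n.
Proof.
elim: n => [|[|n] IH]; first by rewrite derivation1.
  by rewrite !expr0 expr1 mul1r.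
rewrite exprS DM IH /= mulrnAr mulrA -exprS mulrC.
by rewrite [x ^+ n.+1 * D x *+ n.+2]mulrS.
Qed.

Definition der_kernel : {pred B} := fun x => D x == 0.

Fact der_kernel_subring_closed : subring_closed der_kernel.
Proof.
split; rewrite /der_kernel; first by rewrite unfold_in derivation1.
  by move=> x y /eqP x0 /eqP y0; rewrite unfold_in DD derivationN x0 y0 subrr.
by move=> x y /eqP x0 /eqP y0; rewrite unfold_in DM x0 y0 mul0r mulr0 addr0.
Qed.

HB.instance Definition _ :=
  GRing.isSubringClosed.Build B der_kernel der_kernel_subring_closed.

Lemma derivation_horner p s (c : nat -> B) d w :
    (forall i, D p`_i = d * c i) -> D s = d * w ->
  D p.[s] = d * ((\poly_(i < size p) c i).[s] + w * p^`().[s]).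
Proof.
move=> Dp Ds.
rewrite deriv_sum horner_sum horner_coef derivation_sum horner_poly.
rewrite mulr_sumr -big_split mulr_sumr; apply: eq_bigr => i _.
rewrite DM derivationX Dp Ds hornerZ hornerXn /=.
rewrite mulrDr !(mulrnAl, mulrnAr); congr (_ + _); first by ring.
by congr (_ *+ _); ring.
Qed.

(** Read this for the derivation [D / d] of the fraction field: it preserves
[L[s]], the polynomial [v] represents its value at [s], and it raises degrees
in [s] by strictly less than multiplication by [v] does.  The cases that occur
are [v = 1], where it lowers degrees, and [v = w *: 'X], where it does not
raise them. *)
Definition growth L s d v :=
  [/\ v \is a polyOver L, D s = d * v.[s] &
      forall a, a \is a polyOver L -> a != 0 ->
      exists2 b, b \is a polyOver L &
        D a.[s] = d * b.[s] /\ ((size b).+1 < size v + size a)%N].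

Hypothesis B_pchar0 : [pchar B] =i pred0.

Lemma natf_neq0 n : (n.+1%:R == 0 :> B) = false.
Proof. by move/pcharf0P: B_pchar0 => ->. Qed.

Lemma derivation_horner_kernel p s d : p \is a polyOver der_kernel ->
  D s = d -> D p.[s] = d * p^`().[s].
Proof.
move=> /polyOverP pL Ds.
rewrite (@derivation_horner p s (fun=> 0) d 1) ?mulr1 // => [|i].
  by rewrite mul1r horner_poly big1 ?add0r // => i _; rewrite mul0r.
by rewrite mulr0; apply/eqP; apply: pL.
Qed.

(** The derivative of a relation of least degree is a shorter relation. *)
Lemma transcendental_primitive d s : d != 0 -> D s = d ->
  transcendental der_kernel s.
Proof.
move=> d0 Ds p; have [n] := ubnP (size p); elim: n p => // n IH p pn pL ps.
have [-> //|p0] := eqVneq p 0.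
have p'0 : p^`() = 0.
  apply: IH; first exact: leq_trans (lt_size_deriv p0) pn.
    exact: polyOver_deriv.
  have /eqP := derivation_horner_kernel pL Ds.
  by rewrite ps derivation0 eq_sym mulf_eq0 (negPf d0) /= => /eqP.
have pC : p = (p`_0)%:P.
  apply/polyP => -[|i]; rewrite coefC //=; apply/eqP.
  have /eqP : p^`()`_i = 0 by rewrite p'0 coef0.
  by rewrite coef_deriv -mulr_natr mulf_eq0 natf_neq0 orbF.
by move: ps; rewrite pC hornerC => ->.
Qed.

Lemma growth_primitive d s : D s = d -> growth der_kernel s d 1.
Proof.
move=> Ds; split; rewrite ?hornerC ?mulr1 ?rpred1 // => a aL a0.
exists a^`(); first exact: polyOver_deriv.
rewrite (derivation_horner_kernel aL Ds) size_poly1 !ltnS.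
by split=> //; apply: lt_size_deriv.
Qed.

Lemma growth_mem L s d v x : growth L s d v -> x \in adjoin L s ->
  exists2 y, y \in adjoin L s & D x = d * y.
Proof.
case=> _ _ Lv /adjoinP[a aL ->].
have [->|a0] := eqVneq a 0.
  by exists 0; rewrite ?rpred0 // horner0 derivation0 mulr0.
by have [b bL [-> _]] := Lv a aL a0; exists b.[s] => //; apply/adjoinP; exists b.
Qed.

(** Differentiating [t ^+ i] multiplies it by [i] and by the fixed factor
[v.[s]], so [D / d] acts coefficientwise and preserves the degree in [t]. *)
Lemma derivation_horner_exponential L s d v t a :
    growth L s d v -> D t = t * D s -> a \is a polyOver (adjoin L s) ->
  exists c, [/\ forall i, c i \in adjoin L s,
    forall i, D a`_i = d * c i &
    D a.[t] = d * (\poly_(i < size a) (c i + v.[s] * (a`_i *+ i))).[t]].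
Proof.
move=> sv Dt /polyOverP aL; have [vL Ds _] := sv.
have /choice[c cP] i : exists y, y \in adjoin L s /\ D a`_i = d * y.
  by have [y yL Dy] := growth_mem sv (aL i); exists y.
exists c; split=> [i|i|]; try by case: (cP i).
rewrite (derivation_horner (fun i => proj2 (cP i)) (w := t * v.[s])); last first.
  by rewrite Dt Ds; ring.
congr (_ * _); rewrite deriv_sum !horner_poly.
rewrite horner_sum mulr_sumr -big_split; apply: eq_bigr => -[[|i] _] _ /=.
  by rewrite hornerZ !mulr0n mul0r !mulr0 !addr0.
rewrite hornerZ hornerXn exprS; ring.
Qed.

Section Exponential.
Variables (L : subringClosed B) (s d t : B) (v : {poly B}).
Hypotheses (d0 : d != 0) (sL : transcendental L s) (sv : growth L s d v).
Hypotheses (v0 : v != 0) (t0 : t != 0) (Dt : D t = t * D s).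

Let vL : v \is a polyOver L. Proof. by case: sv. Qed.

Lemma value_neq0 : v.[s] != 0.
Proof. by apply/eqP => /(sL vL)/eqP; rewrite (negPf v0). Qed.

Lemma value_mem : v.[s] \in adjoin L s.
Proof. by apply/adjoinP; exists v. Qed.

Lemma growth_exponential : growth (adjoin L s) t d (v.[s] *: 'X).
Proof.
split.
- by rewrite polyOverZ ?polyOverX ?value_mem.
- by case: sv => _ Ds _; rewrite Dt Ds hornerZ hornerX; ring.
move=> a aL a0; have [c [cL _ Da]] := derivation_horner_exponential sv Dt aL.
exists (\poly_(i < size a) (c i + v.[s] * (a`_i *+ i))).
  apply/polyOver_poly => i _.
  by rewrite rpredD // rpredM ?value_mem // rpredMn //; apply/polyOverP.
split=> //; rewrite size_scale ?value_neq0 // size_polyX !ltnS.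
exact: size_poly.
Qed.

(** No positive power of [t] is a quotient of elements of [L[s]] up to a factor
killed by [D]: with [x] and [y] standing for the derivatives of [p.[s]] and [q.[s]], the
excluded identity says that [p.[s] / q.[s]] has the logarithmic derivative of
[t ^+ n.+1]. *)
Lemma cross_derivative_neq (p q : {poly B}) x y n :
    p \is a polyOver L -> q \is a polyOver L -> p != 0 -> q != 0 ->
    D p.[s] = d * x -> D q.[s] = d * y ->
  q.[s] * x != p.[s] * (y + v.[s] * (q.[s] *+ n.+1)).
Proof.
move=> pL qL p0 q0 Dp Dq.
have [_ _ Lv] := sv.
have [p1 p1L [p1s p1_lt]] := Lv p pL p0.
have [q1 q1L [q1s q1_lt]] := Lv q qL q0.
have -> : x = p1.[s] by apply: (mulfI d0); rewrite -Dp.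
have -> : y = q1.[s] by apply: (mulfI d0); rewrite -Dq.
apply/negP; rewrite -subr_eq0 => /eqP e.
have : q * p1 - p * q1 - (p * v * q) *+ n.+1 = 0.
  apply: sL; first by rewrite !(rpredB, rpredM, rpredMn).
  rewrite -e !hornerE hornerMn !hornerM mulrDr !mulrnAr opprD addrA.
  by congr (_ - _ *+ _); ring.
move/eqP; rewrite subr_eq0 => /eqP /(congr1 (fun r : {poly B} => size r)).
rewrite -scaler_nat size_scale ?natf_neq0 // => eq_size.
(* By the growth bound both products have degree less than deg (p * v * q). *)
have : (size (q * p1 - p * q1)%R <=
    maxn (size q + size p1).-1 (size p + size q1).-1)%N.
  rewrite (leq_trans (size_polyD _ _)) // size_polyN geq_max !leq_max.
  by rewrite !size_polyMleq orbT.
rewrite eq_size !size_mul ?mulf_neq0 // -?size_poly_gt0.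
move: p0 q0 v0 p1_lt q1_lt; rewrite -!size_poly_gt0.
lia.
Qed.

(** Eliminating the leading term between a relation of least degree in [t] and
its derivative divided by [d] gives a relation of smaller degree, hence the
zero polynomial; its constant coefficient contradicts [cross_derivative_neq]. *)
Lemma transcendental_exponential : transcendental (adjoin L s) t.
Proof.
move=> a; have [n] := ubnP (size a); elim: n a => // n IH a an aL at0.
apply/eqP/negPn/negP => a0.
(* If the constant coefficient is 0, then a factor t can be cancelled. *)
have [a00|a00] := eqVneq a`_0 0.
  have [a1 ea] : exists a1, a = a1 * 'X.
    by have /factor_theorem : root a 0; [rewrite /root horner_coef0 a00 | rewrite subr0].
  have a10 : a1 != 0 by apply: contraNneq a0 => a10; rewrite ea a10 mul0r.
  case/eqP: (a10); apply: IH.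
  - by move: an; rewrite ea size_mulX.
  - by apply/polyOverP => i; have /polyOverP/(_ i.+1) := aL; rewrite ea coefMX.
  by move/eqP: at0; rewrite ea hornerM hornerX mulf_eq0 (negPf t0) orbF => /eqP.
have [c [cL Dc Da]] := derivation_horner_exponential sv Dt aL.
case en: (size a) => [|[|N]].
- by move/eqP: en; rewrite size_poly_eq0 (negPf a0).
- by move: at0 a00; rewrite {1}[a]size1_polyC ?en // hornerC => -> /eqP.
set b := \poly_(i < _) _ in Da.
have b_t : b.[t] = 0.
  by apply/eqP; move/eqP: Da; rewrite at0 derivation0 eq_sym mulf_eq0 (negPf d0).
have bL : b \is a polyOver (adjoin L s).
  apply/polyOver_poly => i _.
  by rewrite rpredD // rpredM ?value_mem // rpredMn //; apply/polyOverP.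
have e0 : a`_N.+1 *: b - b`_N.+1 *: a = 0.
  apply: IH.
  - apply: (leq_trans _ (an : (size a <= n)%N)); rewrite en ltnS.
    apply/leq_sizeP => i; rewrite leq_eqVlt.
    case/predU1P => [<-|Ni]; rewrite coefB !coefZ; first by rewrite mulrC subrr.
    have ai : a`_i = 0 by rewrite nth_default ?en.
    by rewrite ai coef_poly en ltnNge Ni /= !mulr0 subrr.
  - by rewrite rpredB // polyOverZ //; apply/polyOverP.
  by rewrite hornerD hornerN !hornerZ at0 b_t !mulr0 subrr.
have /adjoinP[p pL ep] : a`_0 \in adjoin L s by apply/polyOverP.
have /adjoinP[q qL eqN] : a`_N.+1 \in adjoin L s by apply/polyOverP.
suff /negP[] : a`_N.+1 * c 0%N != a`_0 * (c N.+1 + v.[s] * (a`_N.+1 *+ N.+1)).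
  have /(congr1 (fun r : {poly B} => r`_0)) := e0.
  rewrite coefB !coefZ !coef_poly en /= mulr0n mulr0 addr0 coef0 ltnSn.
  by move/eqP; rewrite subr_eq0 => /eqP ->; rewrite mulrC.
rewrite ep eqN; apply: cross_derivative_neq => //.
- by apply: contraNneq a00 => p0; rewrite ep p0 horner0.
- apply: contraNneq a0 => q0; rewrite -lead_coef_eq0 lead_coefE en /=.
  by rewrite eqN q0 horner0.
- by rewrite -ep.
- by rewrite -eqN.
Qed.

End Exponential.

(** All the growth bounds are relative to [d = D (t 0)]: the tower starts with
[v = 1], and each exponential leads to a polynomial [v] of degree 1, which is
what the next exponential needs. *)
Theorem transcendental_tower (t : nat -> B) :
    D (t 0%N) != 0 -> (forall m, t m.+1 != 0) ->
    (forall m, D (t m.+1) = t m.+1 * D (t m)) ->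
  forall m, exists L : subringClosed B,
    [/\ {subset der_kernel <= L}, forall j, (j < m)%N -> t j \in L &
        transcendental L (t m)].
Proof.
move=> d0 t0 Dt m.
suff [L [kL tL Lt _]] : exists L : subringClosed B,
    [/\ {subset der_kernel <= L}, forall j, (j < m)%N -> t j \in L,
        transcendental L (t m) &
        exists2 v, v != 0 & growth L (t m) (D (t 0%N)) v].
  by exists L.
elim: m => [|m [L [kL tL Lt [v v0 Lv]]]].
  exists [the subringClosed B of der_kernel]; split=> //.
    exact: transcendental_primitive d0 _.
  by exists 1; [exact: oner_neq0 | exact: growth_primitive].
exists [the subringClosed B of adjoin L (t m)]; split.
- by move=> x /kL; apply: mem_adjoin_base.
- move=> j; rewrite ltnS leq_eqVlt => /predU1P[->|/tL]; first exact: mem_adjoin_gen.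
  exact: mem_adjoin_base.
- exact: transcendental_exponential Lt Lv v0 (t0 m) (Dt m).
exists (v.[t m] *: 'X); last exact: growth_exponential Lt Lv v0 (Dt m).
by rewrite -size_poly_eq0 size_scale ?size_polyX // (value_neq0 Lt Lv v0).
Qed.

End Derivation.
End Transcendence.

(** * From successive transcendence to algebraic independence *)

Section Independence.
Variable B : idomainType.

(** The sequence lists the indices from the last adjoined one to the first.
The ring [L] may vary freely with the index, as long as it contains what was
adjoined before: this allows a different derivation at each step. *)
Fixpoint transcendental_chain (I : eqType) (K : B -> Prop) (e : I -> B)
    (s : seq I) : Prop :=
  if s is i :: s' then
    (exists L : subringClosed B, [/\ forall x, K x -> x \in L,
       {in s', forall j, e j \in L} & transcendental L (e i)])
    /\ transcendental_chain K e s'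
  else True.

(** Induction on [s] works for arbitrary families of exponent vectors that are
separated by their values on [s]: collecting the terms by their degree in the
last adjoined element leaves such a family on the rest of [s]. *)
Lemma chain_monomials_free (I T : eqType) (K : B -> Prop) (e : I -> B) s
    (m : T -> I -> nat) (c : T -> B) (r : seq T) :
    transcendental_chain K e s -> uniq r -> {in r, forall u, K (c u)} ->
    {in r &, forall u w, {in s, m u =1 m w} -> u = w} ->
    \sum_(u <- r) c u * \prod_(i <- s) e i ^+ m u i = 0 ->
  {in r, forall u, c u = 0}.
Proof.
elim: s r => [|i s IH] r /=.
  move=> _; case: r => [//|u [|w r]] /= ru cK inj.
    by rewrite big_seq1 big_nil mulr1 => cu x; rewrite inE => /eqP ->.
  move=> _ x _; have : u = w by apply: inj; rewrite ?inE ?eqxx ?orbT.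
  by move=> e0; move: ru; rewrite e0 inE eqxx.
move=> [[L [KL sL Li]] chain_s] ru cK inj sum0 u ur.
pose p := \sum_(w <- r) (c w * \prod_(j <- s) e j ^+ m w j) *: 'X^(m w i).
have pL : p \is a polyOver L.
  rewrite /p big_seq rpred_sum // => w wr; rewrite polyOverZ ?polyOverXn //.
  rewrite rpredM //; first exact/KL/cK.
  by rewrite big_seq rpred_prod // => j js; rewrite rpredX // sL.
have p0 : p = 0.
  apply: Li => //; rewrite -[RHS]sum0 horner_sum; apply: eq_bigr => w _.
  by rewrite hornerZ hornerXn big_cons [RHS]mulrCA mulrC.
apply: (IH [seq w <- r | m w i == m u i]) => //.
- by rewrite filter_uniq.
- by move=> w; rewrite mem_filter => /andP[_ /cK].
- move=> w x; rewrite !mem_filter => /andP[/eqP wi wr] /andP[/eqP xi xr] wx.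
  by apply: inj => // j; rewrite inE => /predU1P[->|/wx //]; rewrite wi xi.
- rewrite big_filter big_mkcond.
  have /(congr1 (fun q : {poly B} => q`_(m u i))) := p0.
  rewrite coef0 coef_sum => sum0'; rewrite -[RHS]sum0'.
  apply: eq_bigr => w _.
  by rewrite coefZ coefXn eq_sym; case: eqP; rewrite ?mulr1 ?mulr0.
by rewrite mem_filter eqxx.
Qed.

Lemma chain_algebraically_free n (K : B -> Prop) (x : 'I_n -> B) s (P : mpoly n B) :
    transcendental_chain K x s -> perm_eq s (enum 'I_n) ->
    (forall m, K (mcoeff m P)) -> meval x P = 0 ->
  P = 0.
Proof.
move=> chain_s s_enum PK; rewrite mevalE => P0.
apply/mpolyP => m; rewrite mcoeff0.
have [mP|/memN_msupp_eq0 //] := boolP (m \in msupp P).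
have exponents_inj : {in msupp P &, forall u w : multinom n,
    {in s, u =1 w} -> u = w}.
  move=> u w _ _ uw; apply/mnmP => i; apply: uw.
  by rewrite (perm_mem s_enum) mem_enum.
have coefK : {in msupp P, forall u, K (mcoeff u P)} by move=> u _.
apply: (chain_monomials_free chain_s (msupp_uniq P) coefK exponents_inj _ mP).
rewrite -[RHS]P0; apply: eq_bigr => w _; congr (_ * _).
by rewrite (perm_big _ s_enum) big_enum.
Qed.

End Independence.

(** * Arithmetic functions form a domain with derivations *)

Section ArithDomain.
Variable R : realType.
Implicit Types f g h : arith R.

Lemma arith1E n : (1 : arith R) n = (n == 1%N)%:R. Proof. by []. Qed.
Lemma arithDE f g n : (f + g) n = f n + g n. Proof. by []. Qed.
Lemma arithNE f n : (- f) n = - f n. Proof. by []. Qed.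
Lemma arithZE a f n : (a *: f) n = a * f n. Proof. by []. Qed.

Lemma arithM_pairsE f g n N : (0 < n < N)%N ->
  (f * g) n = \sum_(a < N) \sum_(b < N | (a * b == n)%N) f a * g b.
Proof. by case/andP=> n0 nN; rewrite -(arith_convE f g n0 nN). Qed.

Definition vanishes_below f b := forall n, (n < b)%N -> f n = 0.

(** If i * j = a * b with i >= a and j >= b, then i = a and j = b. *)
Lemma arithM_lead f g a b : vanishes_below f a -> vanishes_below g b ->
  (0 < a)%N -> (0 < b)%N -> (f * g) (a * b)%N = f a * g b.
Proof.
move=> fa gb a0 b0; have ab0 : (0 < a * b < (a * b).+1)%N by rewrite muln_gt0 a0 b0 /=.
rewrite (arithM_pairsE f g ab0).
have aN : (a < (a * b).+1)%N by rewrite ltnS leq_pmulr.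
have bN : (b < (a * b).+1)%N by rewrite ltnS leq_pmull.
rewrite (bigD1 (Ordinal aN)) //= (bigD1 (Ordinal bN)) //= big1 ?addr0; last first.
  move=> i /andP[/eqP e]; rewrite -val_eqE /=; case/negP; apply/eqP.
  by apply/eqP; rewrite -(eqn_pmul2l a0) e.
rewrite big1 ?addr0 // => i; rewrite -val_eqE /= => ia.
apply: big1 => j /eqP ij.
have [ltia|] := ltnP i a; first by rewrite fa ?mul0r.
rewrite leq_eqVlt eq_sym (negPf ia) /= => lai.
rewrite gb ?mulr0 // ltnNge; apply/negP => bj.
have : (a * b < i * j)%N.
  by apply: leq_trans (_ : i * b <= _)%N; rewrite ?ltn_pmul2r // leq_mul2l bj orbT.
by rewrite ij ltnn.
Qed.

Lemma vanishes_belowM f g a b : vanishes_below f a -> vanishes_below g b ->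
  vanishes_below (f * g) (a * b).
Proof.
move=> fa gb [|n] nab; first exact: arith_fun0.
rewrite (arithM_pairsE f g (ltnSn n.+1 : (0 < n.+1 < n.+2)%N)).
apply: big1 => i _; apply: big1 => j /eqP ij.
have [ltia|lai] := ltnP i a; first by rewrite fa ?mul0r.
have [ltjb|lbj] := ltnP j b; first by rewrite gb ?mulr0.
by have := leq_mul lai lbj; rewrite ij leqNgt nab.
Qed.

Lemma arith_prod_lead (I : Type) (r : seq I) (h : I -> arith R) (b : I -> nat) :
    (forall i, vanishes_below (h i) (b i)) -> (forall i, (0 < b i)%N) ->
  (\prod_(i <- r) h i) (\prod_(i <- r) b i)%N = \prod_(i <- r) h i (b i).
Proof.
move=> hb b0.
suff [] : vanishes_below (\prod_(i <- r) h i) (\prod_(i <- r) b i)%N /\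
    (\prod_(i <- r) h i) (\prod_(i <- r) b i)%N = \prod_(i <- r) h i (b i) by [].
elim: r => [|i r [IHb IH]].
  by rewrite !big_nil; split=> // -[|n] //; rewrite arith_fun0.
rewrite !big_cons; split; first exact: vanishes_belowM.
by rewrite arithM_lead ?prodn_gt0 // IH.
Qed.

Lemma arith_lead f : f != 0 ->
  exists b, [/\ (0 < b)%N, f b != 0 & vanishes_below f b].
Proof.
move=> f0; case: (anormP f) => [f00|b b0 fb bmin]; first by rewrite f00 eqxx in f0.
exists b; split=> // n nb; apply/eqP/negPn/negP => /bmin; by rewrite leqNgt nb.
Qed.

Fact arith_integral f g : f * g = 0 -> (f == 0) || (g == 0).
Proof.
move=> fg0; apply: contraT; rewrite negb_or => /andP[].
move=> /arith_lead[a [a0 fa0 fa]] /arith_lead[b [b0 gb0 gb]].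
have /eqP : (f * g) (a * b)%N = 0 by rewrite fg0.
by rewrite arithM_lead // mulf_eq0 (negPf fa0) (negPf gb0).
Qed.

(** Inverses chosen by excluded middle: they only serve to make arithmetic
functions an instance of [idomainType]. *)
Definition arith_unit : {pred arith R} := fun f => `[< exists g, g * f = 1 >].
Definition arith_inv f : arith R :=
  if pselect (exists g, g * f = 1) is left ex_g then projT1 (cid ex_g) else f.

Fact arith_mulVf : {in arith_unit, left_inverse 1 arith_inv *%R}.
Proof.
move=> f /asboolP fu; rewrite /arith_inv; case: pselect => // ex_g.
exact: projT2 (cid ex_g).
Qed.
Fact arith_unitP f g : g * f = 1 -> arith_unit f.
Proof. by move=> gf; apply/asboolP; exists g. Qed.
Fact arith_inv_out : {in [predC arith_unit], arith_inv =1 id}.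
Proof.
move=> f /negP fu; rewrite /arith_inv; case: pselect => // ex_g.
by case: fu; apply/asboolP.
Qed.

HB.instance Definition _ := GRing.ComNzRing_hasMulInverse.Build (arith R)
  arith_mulVf arith_unitP arith_inv_out.
HB.instance Definition _ :=
  GRing.ComUnitRing_isIntegral.Build (arith R) arith_integral.

Lemma arith_pchar0 : [pchar (arith R)] =i pred0.
Proof.
apply/pcharf0P => n; apply/eqP/eqP => [|-> //].
move=> /(congr1 (fun f : arith R => f 1%N)).
have -> : (n%:R : arith R) 1%N = n%:R.
  by elim: n => [//|n IH]; rewrite -!natr1 arithDE IH.
by move/eqP; rewrite pnatr_eq0 => /eqP.
Qed.

Lemma arithM_divisorsE f g n : (f * g) n = \sum_(d <- divisors n) f d * g (n %/ d)%N.
Proof. by []. Qed.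

Fact logn_arith_subproof p : (logn p 0)%:R = 0 :> R[i].
Proof. by rewrite logn0. Qed.
Definition logn_arith p : arith R :=
  @Arith R (fun n => (logn p n)%:R) (logn_arith_subproof p).

Lemma pderivE p f n : pderiv p f n = ptmul (logn_arith p) f (n * p)%N.
Proof. by []. Qed.

(** [logn p] is additive on products, so multiplying by it pointwise is a
derivation; [pderiv p] is this one followed by n |-> n * p. *)
Lemma ptmul_lognM p f g :
  ptmul (logn_arith p) (f * g) = ptmul (logn_arith p) f * g + f * ptmul (logn_arith p) g.
Proof.
apply: arithP => n n0; rewrite arithDE /= mulr_sumr -big_split.
rewrite !big_seq; apply: eq_bigr => d; rewrite -dvdn_divisors // => dn /=.
have d0 : (0 < d)%N by apply: dvdn_gt0 n0 dn.
have nd0 : (0 < n %/ d)%N by rewrite divn_gt0 // dvdn_leq.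
by rewrite -{1}(divnK dn) lognM // natrD; ring.
Qed.

(** Only divisors of [n * p] that are multiples of [p] contribute to the
right-hand side. *)
Lemma pderiv_shift p f g n : prime p -> (0 < n)%N ->
  (pderiv p f * g) n = (ptmul (logn_arith p) f * g) (n * p)%N.
Proof.
move=> p_prime n0; have p0 := prime_gt0 p_prime.
have np0 : (0 < n * p)%N by rewrite muln_gt0 n0.
rewrite !arithM_divisorsE [RHS](bigID (fun e => p %| e)%N) /= [X in _ + X]big_seq_cond.
rewrite [X in _ + X]big1 ?addr0; last first.
  by move=> e /andP[_ pe]; rewrite lognE (negPf pe) !andbF !mul0r.
rewrite -[RHS]big_filter.
have multiples : perm_eq [seq e <- divisors (n * p) | p %| e]%N
                       [seq (d * p)%N | d <- divisors n].
  apply: uniq_perm; rewrite ?filter_uniq ?divisors_uniq //.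
    rewrite map_inj_uniq ?divisors_uniq // => d e /eqP.
    by rewrite eqn_pmul2r // => /eqP.
  move=> e; rewrite mem_filter -dvdn_divisors //; apply/andP/mapP.
    case=> /dvdnP[d ->]; rewrite dvdn_pmul2r // => dn.
    by exists d; rewrite // -dvdn_divisors.
  case=> d; rewrite -dvdn_divisors // => dn ->.
  by rewrite dvdn_mull // dvdn_pmul2r.
by rewrite (perm_big _ multiples) big_map; apply: eq_bigr => d _; rewrite divnMr.
Qed.

Lemma pderiv_derivation p : prime p -> derivation (@pderiv R p).
Proof.
move=> p_prime; split=> f g; apply: arithP => n n0.
  by rewrite /= mulrDr.
rewrite pderivE ptmul_lognM !arithDE [f * pderiv p g]mulrC !pderiv_shift //.
by rewrite [f * _]mulrC.
Qed.

Lemma pderivZ p a f : pderiv p (a *: f) = a *: pderiv p f.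
Proof. by apply: arithP => n _ /=; rewrite mulrCA. Qed.

End ArithDomain.

(** * Exponential and logarithm *)

Section ExpLog.
Variable R : realType.
Implicit Types f g h : arith R.

Lemma arithM_local f f' g n : (forall m, (m <= n)%N -> f m = f' m) ->
  (f * g) n = (f' * g) n.
Proof.
case: n => [|n] ff'; first by rewrite !arith_fun0.
rewrite !arithM_divisorsE !big_seq; apply: eq_bigr => d; rewrite -dvdn_divisors // => dn.
by rewrite ff' // dvdn_leq.
Qed.

Lemma Exp0_partial f K n : f 1%N = 0 -> (n <= K)%N ->
  Exp0 f n = (\sum_(k < K) (k`!%:R : R[i])^-1 *: f ^+ k) n.
Proof.
move=> f1 nK; rewrite Exp0E // arith_sumE /=.
rewrite (big_ord_widen K (fun k => (k`!%:R : R[i])^-1 * (f ^+ k) n) nK).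
rewrite big_mkcond; apply: eq_bigr => k _.
by case: ltnP => // nk; rewrite arith_expr_small ?mulr0.
Qed.

Lemma pderiv_Exp0 p f : prime p -> f 1%N = 0 ->
  pderiv p (Exp0 f) = Exp0 f * pderiv p f.
Proof.
move=> p_prime f1; have p_der := pderiv_derivation R p_prime.
(* The value at n only involves the finitely many powers below n * p, which
   turns the series into a finite sum that can be differentiated termwise. *)
apply: arithP => n n0; set K := (n * p)%N.
have nK : (n <= K)%N by rewrite leq_pmulr ?prime_gt0.
have -> : pderiv p (Exp0 f) n =
    pderiv p (\sum_(k < K.+1) (k`!%:R : R[i])^-1 *: f ^+ k) n.
  by rewrite !pderivE /= (Exp0_partial (K := K.+1)) ?leqnSn.
have -> : pderiv p (\sum_(k < K.+1) (k`!%:R : R[i])^-1 *: f ^+ k) =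
    (\sum_(k < K) (k`!%:R : R[i])^-1 *: f ^+ k) * pderiv p f.
  rewrite (derivation_sum p_der) big_ord_recl pderivZ expr0.
  rewrite (derivation1 p_der) scaler0 add0r mulr_suml; apply: eq_bigr => k _.
  rewrite pderivZ (derivationX p_der) -scalerAl.
  rewrite -[X in _ *: X = _](@scaler_nat R[i]) scalerA; congr (_ *: _).
  rewrite lift0 factS natrM invfM mulrAC mulVf ?mul1r //.
  by rewrite pnatr_eq0.
apply: arithM_local => m mn; rewrite (Exp0_partial (K := K)) //.
exact: leq_trans mn nK.
Qed.

Lemma pderiv_alg p a : prime p -> pderiv p (a%:A) = 0 :> arith R.
Proof.
by move=> p_prime; rewrite pderivZ (derivation1 (pderiv_derivation R p_prime)) scaler0.
Qed.

Lemma sub_value1 f : (f - (f 1%N)%:A) 1%N = 0.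
Proof. by rewrite arithDE arithNE arithZE arith1E mulr1 subrr. Qed.

Lemma pderiv_Exp p f : prime p -> pderiv p (Exp f) = Exp f * pderiv p f.
Proof.
move=> p_prime; rewrite /Exp -!scalerAl !mul1r pderivZ pderiv_Exp0 ?sub_value1 //.
by rewrite (derivationB (pderiv_derivation R p_prime)) pderiv_alg // subr0.
Qed.

Lemma Exp0_value1 f : f 1%N = 0 -> Exp0 f 1%N = 1.
Proof.
by move=> f1; rewrite Exp0E //= big_ord1 fact0 invr1 expr0 mul1r.
Qed.

Lemma Exp_value1 f : Exp f 1%N = cexp (f 1%N).
Proof.
by rewrite /Exp -scalerAl mul1r arithZE Exp0_value1 ?mulr1 // sub_value1.
Qed.

Lemma cexp_neq0 (z : R[i]) : cexp z != 0.
Proof.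
case: z => a b; apply/eqP => /eqP.
rewrite eq_complex /= !mulf_eq0 !(gt_eqF (expR_gt0 a)) /=.
case/andP=> /eqP c0 /eqP s0; have := cos2Dsin2 b.
by rewrite c0 s0 expr0n addr0 => /eqP; rewrite eq_sym oner_eq0.
Qed.

Lemma Exp_neq0 f : Exp f != 0.
Proof.
apply/eqP => /(congr1 (fun h : arith R => h 1%N)) /eqP.
by rewrite Exp_value1 (negPf (cexp_neq0 _)).
Qed.

Definition agree_below n f g := forall m, (m < n)%N -> f m = g m.

Lemma arithX_local n f g k : agree_below n f g -> agree_below n (f ^+ k) (g ^+ k).
Proof.
move=> fg; elim: k => [//|k IH] m mn; rewrite !exprS.
rewrite (@arithM_local f g) => [|j jm]; last exact: fg (leq_ltn_trans jm mn).
rewrite ![g * _]mulrC; apply: arithM_local => j jm; exact: IH (leq_ltn_trans jm mn).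
Qed.

(** In a product of at least two functions vanishing at 1, the value at [n] only
involves values at proper divisors of [n]. *)
Lemma arithX_local_strict n f g k : f 1%N = 0 -> g 1%N = 0 ->
  agree_below n f g -> (f ^+ k.+2) n = (g ^+ k.+2) n.
Proof.
move=> f1 g1 fg; case: n fg => [|n] fg; first by rewrite !arith_fun0.
rewrite ![_ ^+ k.+2]exprS !arithM_divisorsE !big_seq; apply: eq_bigr => d.
rewrite -dvdn_divisors // => dn.
have [->|d1] := eqVneq d 1%N; first by rewrite f1 g1 !mul0r.
have d0 : (0 < d)%N by apply: dvdn_gt0 dn.
have [->|dn1] := eqVneq d n.+1.
  by rewrite divnn !arith_expr_small ?mulr0.
have dlt : (d < n.+1)%N by rewrite ltn_neqAle dn1 dvdn_leq.
rewrite fg //; congr (_ * _); apply: (arithX_local _ fg).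
by rewrite ltn_Pdiv // ltn_neqAle eq_sym d1.
Qed.

(** Thus [Exp0] is a strictly causal perturbation of [h |-> 1 + h], which makes
it invertible by successive approximation. *)
Lemma Exp0_local n f g : f 1%N = 0 -> g 1%N = 0 -> agree_below n f g ->
  Exp0 f n - f n = Exp0 g n - g n.
Proof.
move=> f1 g1 fg.
have tail_terms h : h 1%N = 0 -> Exp0 h n - h n =
    (1 : arith R) n + \sum_(k < n) (k.+2`!%:R : R[i])^-1 * (h ^+ k.+2) n.
  move=> h1; rewrite (@Exp0_partial h n.+2) ?leqW //.
  rewrite !big_ord_recl !arithDE !arithZE expr0 invr1 !mul1r arith_sumE.
  by rewrite addrCA [h n + _]addrC addrK.
rewrite (tail_terms f f1) (tail_terms g g1); congr (_ + _); apply: eq_bigr => k _.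
by rewrite (arithX_local_strict _ f1 g1 fg).
Qed.

Lemma Exp0_surj f : f 1%N = 1 -> exists2 h : arith R, h 1%N = 0 & Exp0 h = f.
Proof.
move=> f1.
(* The k-th approximation solves the equation at all arguments below k. *)
have [h_ [h_0 h_S]] : exists h_ : nat -> arith R, h_ 0%N = 0 /\
    forall k n, h_ k.+1 n = h_ k n + (f n - Exp0 (h_ k) n).
  by exists (fun k => iter k (fun h => h + (f - Exp0 h)) 0).
have h_1 k : h_ k 1%N = 0.
  by elim: k => [|k IH]; [rewrite h_0 | rewrite h_S IH Exp0_value1 // f1 subrr addr0].
have h_agree k : agree_below k (Exp0 (h_ k)) f.
  elim: k => [//|k IH] m; rewrite ltnS => mk.
  have same : agree_below m (h_ k.+1) (h_ k).
    by move=> j jm; rewrite h_S IH ?subrr ?addr0 // (leq_trans jm).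
  have /eqP := Exp0_local (h_1 k.+1) (h_1 k) same.
  by rewrite subr_eq => /eqP ->; rewrite h_S; ring.
have h_stable k m : (m < k)%N -> h_ k m = h_ m.+1 m.
  elim: k => // k IH; rewrite ltnS leq_eqVlt => /predU1P[->//|mk].
  by rewrite h_S h_agree // subrr addr0 IH.
have h0 : h_ 1%N 0%N = 0 by exact: arith_fun0.
exists (@Arith R (fun n => h_ n.+1 n) h0); first exact: h_1.
apply: arithP => n n0; set h := Arith _.
have hh : agree_below n.+1 h (h_ n.+1) by move=> m mn; rewrite [RHS]h_stable.
have h1 : h 1%N = 0 by exact: h_1.
have /eqP := Exp0_local h1 (h_1 n.+1) (fun m mn => hh m (ltnW mn)).
rewrite hh // (inj_eq (addIr _)) => /eqP ->.
exact: h_agree.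
Qed.

Lemma Exp_surj f : apos f -> exists2 h, areal h & Exp h = f.
Proof.
rewrite /apos /= => f1; have f10 : f 1%N != 0 by rewrite gt_eqF.
have [h h1 eh] : exists2 h : arith R, h 1%N = 0 & Exp0 h = (f 1%N)^-1 *: f.
  by apply: Exp0_surj; rewrite arithZE mulVf.
move: f1; case ef1: (f 1%N) => [a b] f1.
have [/eqP b0 a0] : b == 0 /\ 0 < a by apply/andP; move: f1; rewrite ltcE /= eq_sym.
pose l : R[i] := (ln a)%:C%C.
have value1 : (h + l%:A) 1%N = l by rewrite arithDE arithZE arith1E h1 add0r mulr1.
exists (h + l%:A).
  by rewrite /areal /mkset value1; apply/complex_realP; exists (ln a) => //.
rewrite /Exp value1 addrK eh -scalerAl mul1r scalerA /= sin0 cos0 mulr0 mulr1.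
by rewrite lnK // -b0 -ef1 mulfV ?scale1r.
Qed.

Lemma LogK f : apos f -> Exp (Log f) = f.
Proof.
move=> /Exp_surj[h h_real eh].
by rewrite /Log pinvK // inE; exists h.
Qed.

End ExpLog.

(** * The Jacobian of an orbit *)

Section Jacobian.
Variable R : realType.
Implicit Types f g h : arith R.

Lemma infinite_nat_above (Q : set nat) k : infinite_set Q -> exists2 p, Q p & (k < p)%N.
Proof.
move=> Q_inf; apply: contrapT => no; apply: Q_inf.
apply: (@sub_finite_set _ _ `I_k.+1); last exact: finite_II.
by move=> p Qp /=; rewrite ltnS leqNgt; apply/negP => kp; apply: no; exists p.
Qed.

Lemma iter_ptmulE g f a n : iter a (ptmul g) f n = g n ^+ a * f n.
Proof.
elim: a => [|a IH]; first by rewrite expr0 mul1r.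
by rewrite iterS -[LHS]/(g n * iter a (ptmul g) f n) IH mulrA exprS.
Qed.

Definition least_support_multiple f p n :=
  [/\ f n != 0, (p %| n)%N & forall m, f m != 0 -> (p %| m)%N -> (n <= m)%N].

Lemma least_support_multiple_gt0 f p n : least_support_multiple f p n -> (0 < n)%N.
Proof. by case: n => // -[]; rewrite arith_fun0 eqxx. Qed.

Lemma least_support_multipleP f p : primes_of (asupp f) p ->
  exists n, least_support_multiple f p n.
Proof.
case=> _ [n fn pn].
have ex_n : exists n, (f n != 0) && (p %| n)%N by exists n; rewrite pn andbT.
case: (ex_minnP ex_n) => m /andP[fm pm] m_min.
by exists m; split=> // j fj pj; apply: m_min; rewrite fj.
Qed.

(** Since p divides N_p, each new prime can be taken larger than all N_p chosen
so far, which makes the N_p increase. *)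
Lemma separated_primes f (Q : set nat) n0 :
    infinite_set Q -> Q `<=` primes_of (asupp f) ->
  exists q N : nat -> nat, [/\ forall j, Q (q j),
    forall j, least_support_multiple f (q j) (N j),
    forall j, (n0 <= N j)%N & injective N].
Proof.
move=> Q_inf Qf.
have /choice[w wP] k : exists pn : nat * nat,
    [/\ Q pn.1, least_support_multiple f pn.1 pn.2 & (k < pn.2)%N].
  have [p Qp kp] := infinite_nat_above k Q_inf.
  have [n pn] := least_support_multipleP (Qf _ Qp).
  exists (p, n); split=> //=; apply: leq_trans kp _; apply: dvdn_leq.
    exact: least_support_multiple_gt0 pn.
  by case: pn.
pose s j := iter j (fun pn : nat * nat => w pn.2) (w n0).
have s_w j : exists k, s j = w k by case: j => [|j]; [exists n0 | exists (s j).2].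
exists (fun j => (s j).1), (fun j => (s j).2).
have N_incr j : ((s j).2 < (s j.+1).2)%N by case: (wP (s j).2).
have N_homo : {homo (fun j => (s j).2) : i j / (i < j)%N}.
  exact: (homo_ltn ltn_trans N_incr).
split=> [j|j|[|j]|i j eij].
- by have [k ->] := s_w j; case: (wP k).
- by have [k ->] := s_w j; case: (wP k).
- by case: (wP n0) => _ _ /ltnW.
- by case: (wP n0) => _ _ /ltnW n0s; apply: leq_trans n0s (ltnW (N_homo 0%N j.+1 _)).
by case: (ltngtP i j) => // /N_homo; rewrite eij ltnn.
Qed.

Lemma arith_signM (b : bool) f n : ((-1) ^+ b * f) n = (-1) ^+ b * f n.
Proof. by rewrite !mulr_sign; case: b. Qed.

(** The bounds depend on the row only, so all terms of the Leibniz expansion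
have their leading term at the same place. *)
Lemma arith_det_lead r (M : 'M[arith R]_r) (b : 'I_r -> nat) :
    (forall j a, vanishes_below (M j a) (b j)) -> (forall j, (0 < b j)%N) ->
  (\det M) (\prod_j b j)%N = \det (\matrix_(j, a) M j a (b j)).
Proof.
move=> Mb b0; rewrite /determinant arith_sumE; apply: eq_bigr => s _.
rewrite arith_signM; congr (_ * _).
rewrite (@arith_prod_lead _ _ _ (fun j => M j (s j)) b) //.
by apply: eq_bigr => j _; rewrite mxE.
Qed.

Lemma pderiv_orbit_lead f g p n a : least_support_multiple f p n -> prime p ->
  vanishes_below (pderiv p (iter a (ptmul g) f)) (n %/ p) /\
  pderiv p (iter a (ptmul g) f) (n %/ p)%N = g n ^+ a * ((logn p n)%:R * f n).
Proof.
move=> [fn pn n_min] p_prime; have p0 := prime_gt0 p_prime; split=> [m mn|].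
  rewrite pderivE /= iter_ptmulE; have [->|fm] := eqVneq (f (m * p)%N) 0.
    by rewrite !mulr0.
  have := n_min _ fm (dvdn_mull _ (dvdnn p)).
  by rewrite -{1}(divnK pn) leq_pmul2r // leqNgt mn.
by rewrite pderivE /= divnK // iter_ptmulE mulrCA.
Qed.

Lemma Vandermonde_neq0 (F : fieldType) r (z : 'I_r -> F) : injective z ->
  \det (Vandermonde r (\row_j z j)) != 0.
Proof.
move=> z_inj; rewrite det_Vandermonde; apply/prodf_neq0 => i _.
apply/prodf_neq0 => j ij; rewrite !mxE subr_eq0 (inj_eq z_inj).
by apply: contraTneq ij => ->; rewrite ltnn.
Qed.

Lemma orbit_jacobian_neq0 f g (Q : set nat) r : eventually_injective g ->
    infinite_set Q -> Q `<=` primes_of (asupp f) ->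
  exists2 q : 'I_r -> nat, (forall j, Q (q j)) &
    \det (\matrix_(j < r, a < r) pderiv (q j) (iter a (ptmul g) f)) != 0.
Proof.
move=> [n0 g_inj] Q_inf Qf.
have [q [N [Qq qN n0N N_inj]]] := separated_primes n0 Q_inf Qf.
have q_prime j : prime (q j) by case: (Qf _ (Qq j)).
have N0 j : (0 < N j)%N by apply: least_support_multiple_gt0 (qN j).
have qdvd j : (q j %| N j)%N by case: (qN j).
exists (fun j => q j) => //; set M := \matrix_(j, a) _.
apply/eqP => /(congr1 (fun h : arith R => h (\prod_(j < r) (N j %/ q j))%N)).
rewrite (@arith_det_lead r M (fun j => N j %/ q j)%N); first last.
- by move=> j; rewrite divn_gt0 ?prime_gt0 // dvdn_leq.
- by move=> j a; rewrite mxE; case: (pderiv_orbit_lead g a (qN j) (q_prime j)).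
have -> : \matrix_(j, a) M j a (N j %/ q j)%N =
    diag_mx (\row_j ((logn (q j) (N j))%:R * f (N j)))
      *m (Vandermonde r (\row_j g (N j)))^T.
  apply/matrixP => j a; rewrite mul_diag_mx !mxE.
  by have [_ ->] := pderiv_orbit_lead g a (qN j) (q_prime j); rewrite mulrC.
apply/eqP; rewrite det_mulmx det_tr det_diag mulf_neq0 //.
  apply/prodf_neq0 => j _; rewrite mxE mulf_neq0 //; last by case: (qN j).
  by rewrite pnatr_eq0 -lt0n logn_gt0 mem_primes q_prime N0 qdvd.
apply: Vandermonde_neq0 => i j /= /g_inj eij; apply/val_inj/N_inj/eij; rewrite inE //=.
Qed.

End Jacobian.

(** * Separating the towers *)

Section DualDerivations.
Variable B : idomainType.

Lemma derivation_comb r (D : 'I_r -> B -> B) (c : 'I_r -> B) :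
  (forall j, derivation (D j)) -> derivation (fun x => \sum_j c j * D j x).
Proof.
move=> D_der; split=> x y.
  rewrite -big_split; apply: eq_bigr => j _.
  by case: (D_der j) => -> _; rewrite mulrDr.
rewrite mulr_suml mulr_sumr -big_split; apply: eq_bigr => j _.
by case: (D_der j) => _ ->; rewrite /=; ring.
Qed.

(** With [N] the matrix of the [D j (y a)], these are, up to the factor
[\det N], the partial derivatives with respect to the [y a]. *)
Definition dual_derivation r (D : 'I_r -> B -> B) (N : 'M[B]_r) (a : 'I_r) (x : B) : B :=
  \sum_j \adj N a j * D j x.

Lemma dual_derivation_val r (D : 'I_r -> B -> B) (y : 'I_r -> B) a b :
  let N := \matrix_(j, c) D j (y c) in
  dual_derivation D N a (y b) = \det N *+ (a == b).
Proof.
move=> N; transitivity ((\adj N *m N) a b).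
  by rewrite [RHS]mxE; apply: eq_bigr => j _; rewrite [N _ _]mxE.
by rewrite mul_adj_mx mxE.
Qed.

(** Only elements of smaller or equal height [m] are adjoined before [x i], so
the ring for [i] has to contain no others. *)
Lemma sorted_chain n (K : B -> Prop) (x : 'I_n -> B) (m : 'I_n -> nat) :
    (forall i, exists L : subringClosed B, [/\ forall c, K c -> c \in L,
       forall j, j != i -> (m j <= m i)%N -> x j \in L & transcendental L (x i)]) ->
  exists2 s, perm_eq s (enum 'I_n) & transcendental_chain K x s.
Proof.
move=> xL; pose ge_m i j := (m j <= m i)%N.
exists (sort ge_m (enum 'I_n)); first by rewrite perm_sort.
have ge_m_trans : transitive ge_m by move=> j i k ij jk; apply: leq_trans jk ij.
have : uniq (sort ge_m (enum 'I_n)) by rewrite sort_uniq enum_uniq.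
have : pairwise ge_m (sort ge_m (enum 'I_n)).
  rewrite -(sorted_pairwise ge_m_trans); apply: sort_sorted => i j.
  exact: leq_total.
elim: (sort _ _) => //= i s IH /andP[/allP ge_i s_sorted] /andP[i_notin s_uniq].
split; last exact: IH.
have [L [KL mL Lx]] := xL i.
exists L; split=> // j js; apply: mL; last exact: ge_i.
by apply: contraNneq i_notin => <-.
Qed.

End DualDerivations.

Section Core.
Variable R : realType.
Implicit Types f g h : arith R.

Lemma pderiv_iter_Exp p k h : prime p ->
  pderiv p (iter k (@Exp R) h) = (\prod_(j < k) iter j.+1 (@Exp R) h) * pderiv p h.
Proof.
move=> p_prime; elim: k => [|k IH]; first by rewrite big_ord0 mul1r.
by rewrite iterS pderiv_Exp // IH big_ord_recr mulrA iterS [Exp _ * _]mulrC.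
Qed.

Lemma iter_Exp_Log k f : Log_defined k f ->
  iter k (@Exp R) (iter k (@Log R) f) = f.
Proof.
elim: k f => [//|k IH] f /= [f_pos f_def].
by rewrite -[Log (iter k _ f)]iterS iterSr IH // LogK.
Qed.

(** Applying Exp k times to the [a]-th function multiplies the [a]-th column of
the Jacobian matrix by a fixed product of exponentials. *)
Lemma log_orbit_jacobian_neq0 f g (Q : set nat) r k : eventually_injective g ->
    infinite_set Q -> Q `<=` primes_of (asupp f) ->
    (forall a, (a < r)%N -> Log_defined k (iter a (ptmul g) f)) ->
  exists2 q : 'I_r -> nat, (forall j, Q (q j)) &
    \det (\matrix_(j < r, a < r)
      pderiv (q j) (iter k (@Log R) (iter a (ptmul g) f))) != 0.
Proof.
move=> g_inj Q_inf Qf f_def.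
have [q Qq det_neq0] := orbit_jacobian_neq0 r g_inj Q_inf Qf.
exists q => //; apply: contraNneq det_neq0 => det0.
pose y a := iter k (@Log R) (iter a (ptmul g) f).
have -> : \matrix_(j < r, a < r) pderiv (q j) (iter a (ptmul g) f) =
    (\matrix_(j < r, a < r) pderiv (q j) (y a)) *m
    diag_mx (\row_(a < r) \prod_(i < k) iter i.+1 (@Exp R) (y a)).
  apply/matrixP => j a; rewrite mul_mx_diag !mxE.
  have q_prime : prime (q j) by case: (Qf _ (Qq j)).
  by rewrite -[in LHS](iter_Exp_Log (f_def a (ltn_ord a))) pderiv_iter_Exp // mulrC.
by rewrite det_mulmx det0 mul0r.
Qed.

Definition killed_by (Q : set nat) (c : arith R) := forall p, Q p -> pderiv p c = 0.

Theorem exp_orbit_independent f g (Q : set nat) r k n (a : 'I_n -> 'I_r)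
    (m : 'I_n -> nat) (x : 'I_n -> arith R) (P : mpoly n (arith R)) :
    eventually_injective g -> infinite_set Q -> Q `<=` primes_of (asupp f) ->
    (forall b, (b < r)%N -> Log_defined k (iter b (ptmul g) f)) ->
    (forall i, x i = iter (m i) (@Exp R) (iter k (@Log R) (iter (a i) (ptmul g) f))) ->
    injective x -> (forall u, killed_by Q (mcoeff u P)) -> meval x P = 0 ->
  P = 0.
Proof.
move=> g_inj Q_inf Qf f_def xE x_inj PQ Px0.
have [q Qq] := log_orbit_jacobian_neq0 g_inj Q_inf Qf f_def.
pose y (b : 'I_r) := iter k (@Log R) (iter b (ptmul g) f).
set N := \matrix_(j, b) _ => N0.
have q_prime j : prime (q j) by case: (Qf _ (Qq j)).
pose D b := dual_derivation (fun j => @pderiv R (q j)) N b.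
have D_der b : derivation (D b).
  by apply: derivation_comb => j; apply: pderiv_derivation.
have Dy b c : D b (y c) = \det N *+ (b == c).
  exact: (dual_derivation_val (fun j => @pderiv R (q j)) y).
have D_Exp b h : D b (Exp h) = Exp h * D b h.
  rewrite /D /dual_derivation mulr_sumr; apply: eq_bigr => j _.
  by rewrite pderiv_Exp // mulrCA.
have D_iter b c i : b != c -> D b (iter i (@Exp R) (y c)) = 0.
  move=> bc; elim: i => [|i IH]; first by rewrite Dy (negPf bc).
  by rewrite iterS D_Exp IH mulr0.
have D_killed b c : killed_by Q c -> D b c = 0.
  by move=> cQ; apply: big1 => j _; rewrite cQ ?mulr0.
have [i|s s_enum s_chain] := @sorted_chain _ n (killed_by Q) x m.
  have [|l|l|L [kL tL Lt]] := transcendental_tower (D_der (a i))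
    (@arith_pchar0 R) (t := fun l => iter l (@Exp R) (y (a i))) _ _ _ (m i).
  - by rewrite /= Dy eqxx.
  - exact: Exp_neq0.
  - by rewrite iterS D_Exp.
  exists L; rewrite xE; split=> // [c /D_killed Dc|j ji mji].
    by apply: kL; apply/eqP.
  (* The elements of the other towers are killed by [D (a i)]; within the same
     tower, distinct elements have distinct heights. *)
  rewrite xE; have [eij|nij] := eqVneq (a i) (a j); last first.
    by apply: kL; apply/eqP; apply: D_iter.
  rewrite -eij; apply: tL; rewrite ltn_neqAle mji andbT.
  by apply: contraNneq ji => mij; apply/eqP/x_inj; rewrite !xE -eij mij.
exact: chain_algebraically_free s_chain s_enum PQ Px0.
Qed.

End Core.

(** * The orbit closed under exponentials and logarithms *)

Section ExpStar.
Variable R : realType.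
Implicit Types (f g h : arith R) (W X : set (arith R)).

Lemma Log_depthP W : Log_defined_on W (Log_depth W).
Proof. by rewrite /Log_depth; case: xgetP => [k _ [] //|_ f _]. Qed.

Lemma Log_definedD i j f : Log_defined (i + j) f ->
  Log_defined i (iter j (@Log R) f).
Proof.
elim: j f => [|j IH] f; first by rewrite addn0.
by rewrite addnS iterSr /= => -[_]; apply: IH.
Qed.

(** Starting all towers at depth [Log_depth W] avoids the logarithms in
[ExpStar W]. *)
Lemma ExpStarE W x : ExpStar W x -> exists2 f, W f &
  exists m, x = iter m (@Exp R) (iter (Log_depth W) (@Log R) f).
Proof.
case=> f Wf [m m_ge <-]; exists f => //; set k := Log_depth W in m_ge *.
have f_def : Log_defined k f by apply: Log_depthP Wf.
case: m m_ge => [l _|l] /=.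
  by exists (l + k)%N; rewrite iterD iter_Exp_Log.
rewrite NegzE lerN2 lez_nat => lk; exists (k - l.+1)%N.
rewrite -{2}(subnK lk) iterD iter_Exp_Log //.
by apply: Log_definedD; rewrite subnK.
Qed.

(** Independence over the kernels, phrased with primes instead of sets of
derivations and with the coefficients of one polynomial at a time; the latter
covers coefficients in [Sfin], which lies in no single kernel. *)
Definition free_over_kernels f X :=
  forall (Q : set nat) n (x : 'I_n -> arith R) (P : mpoly n (arith R)),
    infinite_set Q -> Q `<=` primes_of (asupp f) -> injective x ->
    (forall i, X (x i)) -> (forall u, killed_by Q (mcoeff u P)) ->
  meval x P = 0 -> P = 0.

Lemma free_over_dkernel f X (D : set (arith R -> arith R)) :
    free_over_kernels f X -> D `<=` Delta f -> infinite_set D ->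
  alg_indep (dkernel D) X.
Proof.
move=> X_free Df D_inf n x x_inj xX P PD.
apply: (X_free [set p | primes_of (asupp f) p /\ D (@pderiv R p)]) => //.
- apply: contra_not D_inf => /(finite_image (@pderiv R)); apply: sub_finite_set.
  by move=> d Dd; have [p fp ep] := Df d Dd; exists p => //=; rewrite ep.
- by move=> p [].
- by move=> u p [_ Dp]; apply: PD.
Qed.

(** Finitely many coefficients in [Sfin] involve finitely many primes, and
[pderiv p] kills them for all other [p]. *)
Lemma free_over_Sfin f X : ~ Sfin f -> free_over_kernels f X ->
  alg_indep Sfin X.
Proof.
move=> f_inf X_free n x x_inj xX P PS.
pose S := \bigcup_(u in [set` msupp P]) primes_of (asupp (mcoeff u P)).
apply: (X_free (primes_of (asupp f) `\` S)) => //.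
  apply: infinite_setD => //.
  by apply: bigcup_finite => [|u _]; [exact: finite_seq | exact: PS].
move=> u p [fp pS]; apply: arithP => i _; rewrite pderivE /=.
have [->|c0] := eqVneq (mcoeff u P (i * p)%N) 0; first by rewrite mulr0.
case: pS; exists u; last first.
  by case: fp => p_prime _; split=> //; exists (i * p)%N; rewrite // dvdn_mull.
by rewrite /= mcoeff_msupp; apply: contraNneq c0 => ->.
Qed.

Lemma orbit_ExpStar_free f g W (Q : set nat) n (x : 'I_n -> arith R)
    (P : mpoly n (arith R)) :
    eventually_injective g -> infinite_set Q -> Q `<=` primes_of (asupp f) ->
    (forall a, W (iter a (ptmul g) f)) ->
    (forall i, exists a m,
       x i = iter m (@Exp R) (iter (Log_depth W) (@Log R) (iter a (ptmul g) f))) ->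
    injective x -> (forall u, killed_by Q (mcoeff u P)) -> meval x P = 0 ->
  P = 0.
Proof.
move=> g_inj Q_inf Qf Wf /choice[a /choice[m xE]].
have a_lt i : (a i < (\max_i a i).+1)%N by rewrite ltnS leq_bigmax.
apply: (exp_orbit_independent (k := Log_depth W) (a := fun i => Ordinal (a_lt i))
  (m := m) g_inj Q_inf Qf) => //.
by move=> b _; apply: Log_depthP.
Qed.

Lemma nat_orbit_free f g : eventually_injective g ->
  free_over_kernels f (ExpStar [set iter i (ptmul g) f | i in [set: nat]]).
Proof.
move=> g_inj Q n x P Q_inf Qf x_inj xX.
apply: (orbit_ExpStar_free (W := [set iter i (ptmul g) f | i in setT])
  g_inj Q_inf Qf _ _ x_inj) => [a|i]; first by exists a.
by have [_ [a _ <-] [m ->]] := ExpStarE (xX i); exists a, m.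
Qed.

Section Units.
Variable g : arith R.
Hypothesis g_neq0 : nowhere_vanishing g.

Lemma ptmulzE z f n : (0 < n)%N -> ptmulz g z f n = g n ^ z * f n.
Proof.
move=> n0; case: z => [l|l]; first exact: iter_ptmulE.
have pinvE h : pinv setT (ptmul g) h n = (g n)^-1 * h n.
  have hK : ptmul g (pinv setT (ptmul g) h) = h.
    apply: pinvK; rewrite inE.
    have h0 : (g 0%N)^-1 * h 0%N = 0 by rewrite (arith_fun0 h) mulr0.
    exists (@Arith R (fun n => (g n)^-1 * h n) h0) => //.
    by apply: arithP => i i0 /=; rewrite mulVKf ?g_neq0.
  by rewrite -[in RHS]hK /= mulKf ?g_neq0.
rewrite /ptmulz /ziter /exprz -exprVn.
elim: l.+1 => [|i IH]; first by rewrite expr0 mul1r.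
by rewrite iterS pinvE IH mulrA exprS.
Qed.

Lemma asupp_ptmulz z f : asupp (ptmulz g z f) = asupp f.
Proof.
apply/seteqP; split=> -[|n]; rewrite /asupp /mkset ?arith_fun0 ?eqxx // ptmulzE //.
  by rewrite mulf_eq0 negb_or => /andP[].
by move=> fn; rewrite mulf_neq0 // expfz_neq0 ?g_neq0.
Qed.

Lemma iter_ptmul_ptmulz a z f :
  iter a (ptmul g) (ptmulz g z f) = ptmulz g (z + a%:Z) f.
Proof.
apply: arithP => n n0; rewrite iter_ptmulE !ptmulzE // expfzDr ?g_neq0 //.
by rewrite mulrCA mulrA.
Qed.

Lemma int_orbit_free f : eventually_injective g ->
  free_over_kernels f (ExpStar [set ptmulz g i f | i in [set: int]]).
Proof.
move=> g_inj Q n x P Q_inf Qf x_inj xX.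
have /choice[z zP] i : exists z, exists m, x i = iter m (@Exp R)
    (iter (Log_depth [set ptmulz g i f | i in [set: int]]) (@Log R) (ptmulz g z f)).
  by have [_ [z _ <-] [m ->]] := ExpStarE (xX i); exists z, m.
(* A common lower bound for the exponents that occur. *)
pose lo : int := - (\sum_i `|z i|%N)%:Z.
have z_lo i : z i = lo + `|z i - lo|%N%:Z.
  have : (`|z i| <= \sum_i `|z i|)%N by rewrite (bigD1 i) //= leq_addr.
  rewrite /lo; lia.
rewrite -(asupp_ptmulz lo) in Qf.
apply: (orbit_ExpStar_free (W := [set ptmulz g i f | i in setT])
  g_inj Q_inf Qf _ _ x_inj) => [a|i].
  by exists (lo + a%:Z) => //; rewrite iter_ptmul_ptmulz.
have [m ->] := zP i; exists `|z i - lo|%N, m.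
by rewrite iter_ptmul_ptmulz -z_lo.
Qed.

End Units.
End ExpStar.

Theorem theorem5p3 (R : realType) (g f : arith R)
    (g_inj : eventually_injective g) (f_notin_S : ~ Sfin f) :
  ((forall D : set (arith R -> arith R), D `<=` Delta f -> infinite_set D ->
      alg_indep (dkernel D) (ExpStar [set iter i (ptmul g) f | i in [set: nat]]))
   /\ alg_indep (Sfin) (ExpStar [set iter i (ptmul g) f | i in [set: nat]]))
  /\
  (nowhere_vanishing g ->
   (forall D : set (arith R -> arith R), D `<=` Delta f -> infinite_set D ->
      alg_indep (dkernel D) (ExpStar [set ptmulz g i f | i in [set: int]]))
   /\ alg_indep (Sfin) (ExpStar [set ptmulz g i f | i in [set: int]])).
Proof.
split=> [|g_neq0].
  have X_free := nat_orbit_free (f := f) g_inj.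
  split; [move=> D; exact: free_over_dkernel | exact: free_over_Sfin f_notin_S _].
have X_free := int_orbit_free g_neq0 (f := f) g_inj.
split; [move=> D; exact: free_over_dkernel | exact: free_over_Sfin f_notin_S _].
Qed.
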